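(* Let $q\ge2$ be an integer and let $p_0,\dots,p_{q-1}$ be non-negative real numbers with $\sum_{j=0}^{q-1}p_j=1$. Define $f_0(x)=x$ on $[0,1]$ and $f_{n}=Tf_{n-1}$ for $n\ge1$, so $f_n=T^n x$, where $T$ is the operator defined in the context. Then for every $n\ge1$, $$\text{Arclength of the graph of } f_n \text{ on } [0,1]=\sum_{i=0}^{q^n-1}\sqrt{\left(\frac{1}{q^n}\right)^2+\left(\Pi_n(v_i)\right)^2},$$ where $v_0,\dots,v_{q^n-1}$ and $\Pi_n$ are as defined in the context.
   Context: The numbers $p_j$ are the probabilities $\mathbb{P}[x_i=j]$ of the outcomes of each toss of a (possibly unfair) $q$-sided die. For a function $f$ on $[0,1]$, $Tf$ is defined by: for $k\in\{0,\dots,q-1\}$ and $\frac{k}{q}\le x\le\frac{k+1}{q}$, $$(Tf)(x)=\sum_{j=0}^{k-1}p_j+p_k\,f(qx-k),$$ with the empty sum equal to $0$. For continuous $f$ with $f(0)=0$ and $f(1)=1$ the formulas at the breakpoints $k/q$ agree and $Tf$ is again continuous with $Tf(0)=0$, $Tf(1)=1$; thus all $f_n$ are well defined. The $q^n$ tuples $v_i$, $0\le i\le q^n-1$, are the $n$-tuples of probabilities indexed lexicographically by their indices: if $i=\sum_{m=1}^n d_m q^{n-m}$ with $d_m\in\{0,\dots,q-1\}$, then $v_i=(p_{d_1},p_{d_2},\dots,p_{d_n})$ (tuples with different index sequences are counted separately even if some $p_j$ coincide). The map $\Pi_n$ multiplies the coordinates: $\Pi_n(v_i)=p_{d_1}p_{d_2}\cdots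 p_{d_n}$. *)

(* Defs.v *)
From mathcomp Require Import all_boot all_order all_algebra.
From mathcomp Require Import boolp classical_sets reals ereal numfun.

Set Implicit Arguments.
Unset Strict Implicit.
Unset Printing Implicit Defensive.

Import Order.TTheory GRing.Theory Num.Theory.
Local Open Scope classical_set_scope.
Local Open Scope ring_scope.

Section Arclength.
Context {R : realType}.
Implicit Types (a b : R) (f : R -> R) (s : seq R).

(* Length of the polygonal line inscribed in the graph of f with vertices
   above the partition a :: s of [a, b]; compare [numfun.variation]. *)
Definition polygonal_length a b f s : R :=
  let X := nth b (a :: s) in
  \sum_(0 <= i < size s)
    Num.sqrt ((X i.+1 - X i) ^+ 2 + (f (X i.+1) - f (X i)) ^+ 2).

(* Arclength of the graph of f on [a, b]; it is +oo if the graph is not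
   rectifiable. *)
Definition arclength a b f : \bar R :=
  ereal_sup [set (polygonal_length a b f s)%:E | s in itv_partition a b].

End Arclength.

Section DieOperator.
Context {R : realType} {q : nat}.
(* The probability p_j of outcome j is [p`_j], for j < q. *)
Variable p : q.-tuple R.
Implicit Types (f : R -> R) (x : R).

Definition die_branch f (k : nat) x : R :=
  \sum_(j < k) p`_j + p`_k * f (q%:R * x - k%:R).

Definition in_cell x (k : nat) : bool := k%:R / q%:R <= x <= k.+1%:R / q%:R.

(* At a breakpoint two values of k are eligible; [die_opE] below shows that the
   choice is immaterial when f 0 = 0 and f 1 = 1.  The value outside [0, 1] is
   irrelevant. *)
Definition die_op f x : R :=
  if [pick k : 'I_q | in_cell x k] is Some k then die_branch f k x else 0.

Definition die_iter (n : nat) : R -> R := iter n die_op id.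

(* The digit d_m of i = \sum_(1 <= m <= n) d_m q^(n-m) is
   (i %/ q^(n-m)) %% q, and the m-th coordinate of the tuple has index m - 1. *)
Definition die_tuple (n i : nat) : n.-tuple R :=
  [tuple p`_((i %/ q ^ (n - m.+1)) %% q) | m < n].

Definition coord_prod (n : nat) (v : n.-tuple R) : R := \prod_(m < n) tnth v m.

Hypothesis q_gt0 : (0 < q)%N.

Let qR_gt0 : 0 < q%:R :> R.
Proof. by rewrite ltr0n. Qed.

Lemma die_branch_eq f x (k l : nat) : f 0 = 0 -> f 1 = 1 ->
  (k < l)%N -> in_cell x k -> in_cell x l -> die_branch f k x = die_branch f l x.
Proof.
move=> f0 f1 kl /andP[_ xk] /andP[xl _].
have : l%:R / q%:R <= k.+1%:R / q%:R :> R by exact: le_trans xl xk.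
rewrite ler_pM2r ?invr_gt0// ler_nat => lk.
have El : l = k.+1 by apply/eqP; rewrite eqn_leq lk kl.
have qx : q%:R * x = k.+1%:R.
  have -> : x = k.+1%:R / q%:R by apply/eqP; rewrite eq_le xk -El xl.
  by rewrite mulrC divfK ?gt_eqF.
rewrite El /die_branch qx subrr f0 mulr0 addr0 big_ord_recr /=.
by rewrite -natrB// subSnn f1 mulr1.
Qed.

Lemma die_opE f (k : nat) x : f 0 = 0 -> f 1 = 1 -> (k < q)%N ->
  k%:R / q%:R <= x <= k.+1%:R / q%:R ->
  die_op f x = \sum_(j < k) p`_j + p`_k * f (q%:R * x - k%:R).
Proof.
move=> f0 f1 kq xk; rewrite /die_op; case: pickP => [l xl|/(_ (Ordinal kq))]; last first.
  by rewrite /in_cell /= xk.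
rewrite -[RHS]/(die_branch f k x).
have [kl|lk|->//] := ltngtP k l.
- by rewrite (die_branch_eq f0 f1 kl xk xl).
- by rewrite (die_branch_eq f0 f1 lk xl xk).
Qed.

Hypothesis p_sum1 : \sum_(j < q) p`_j = 1.

Lemma die_iter01 n : die_iter n 0 = 0 /\ die_iter n 1 = 1.
Proof.
elim: n => [//|n [f0 f1]]; rewrite /die_iter /= -/(die_iter n); split.
  rewrite (@die_opE _ 0)// ?mul0r ?lexx ?divr_ge0// ?big_ord0.
  by rewrite mulr0 subrr f0 mulr0 addr0.
have sumE m : (0 < m)%N ->
    \sum_(j < m) p`_j = \sum_(j < m.-1) p`_j + p`_m.-1.
  by case: m => // m _; rewrite big_ord_recr.
rewrite (@die_opE _ q.-1)// ?prednK// ?divff ?gt_eqF// ?lexx ?andbT.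
- have q1 : (q - q.-1 = 1)%N by rewrite -[X in (X - _)%N](prednK q_gt0) subSnn.
  by rewrite mulr1 -natrB ?leq_pred// q1 f1 mulr1 -p_sum1 (sumE q).
- by rewrite ler_pdivrMr// mul1r ler_nat leq_pred.
Qed.

Lemma die_iterS n (k : nat) x : (k < q)%N ->
  k%:R / q%:R <= x <= k.+1%:R / q%:R ->
  die_iter n.+1 x
  = \sum_(j < k) p`_j + p`_k * die_iter n (q%:R * x - k%:R).
Proof. by have [f0 f1] := die_iter01 n => kq xk; exact: die_opE. Qed.

End DieOperator.

Lemma base_expansion_lt (q n : nat) (d : 'I_n -> 'I_q) :
  (\sum_(m < n) d m * q ^ (n - m.+1) < q ^ n)%N.
Proof.
elim: n d => [|n IH] d; first by rewrite big_ord0.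
rewrite big_ord_recl /= subSS subn0.
have := IH (fun m => d (lift ord0 m)).
rewrite -(ltn_add2l (d ord0 * q ^ n)) => /leq_trans; apply.
by rewrite -mulSnr expnS leq_mul2r ltn_ord orbT.
Qed.

Lemma base_expansion_digit (q n : nat) (d : 'I_n -> 'I_q) (m : 'I_n) :
  ((\sum_(k < n) d k * q ^ (n - k.+1)) %/ q ^ (n - m.+1) %% q = d m)%N.
Proof.
have q0 : (0 < q)%N by exact: leq_ltn_trans (ltn_ord (d m)).
elim: n => [|n IH] in d m *; first by case: m.
rewrite big_ord_recl /= subSS subn0.
have lt_n := base_expansion_lt (fun i => d (lift ord0 i)).
case: (unliftP ord0 m) => [m' ->|->] /=.
  rewrite [X in ((X * _ + _) %/ _)%N]/= -[in RHS](IH (fun i => d (lift ord0 i))).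
  rewrite [bump 0 m']add1n subSS.
  have -> : (q ^ n = q ^ m' * q * q ^ (n - m'.+1))%N.
    by rewrite -expnSr -expnD subnKC.
  by rewrite mulnA divnMDl ?expn_gt0 ?q0// mulnA modnMDl.
rewrite subSS subn0 divnMDl ?expn_gt0 ?q0// divn_small// addn0 modn_small//.
Qed.

Lemma die_tupleE (R : realType) (q : nat) (p : q.-tuple R) (n : nat)
    (d : 'I_n -> 'I_q) :
  die_tuple p n (\sum_(m < n) d m * q ^ (n - m.+1))%N
  = [tuple p`_(d m) | m < n].
Proof.
by apply: eq_from_tnth => m; rewrite !tnth_mktuple base_expansion_digit.
Qed.

(* Main.v *)
Require Import Defs.
From mathcomp Require Import all_boot all_order all_algebra.
From mathcomp Require Import boolp classical_sets reals ereal numfun.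
From mathcomp Require Import lra.
Import Order.TTheory GRing.Theory Num.Theory.
Local Open Scope ring_scope.

(** Each f_n is piecewise affine on the uniform grid of step 1/N, N = q^n, and
    its graph is therefore a polygon; the content is that the increment of f_n
    over the i-th cell is Pi_n(v_i).

    Piecewise affine functions are handled through one global formula instead of
    cell by cell: with [ramp] the truncation of the line to [0, 1], the function
    [ramp_sum N c], x |-> \sum_i c_i ramp (N x - i), vanishes at 0, is affine on
    each cell, and increases by c_i on the i-th one.

    - [die_iter_ramp_sum]: f_n = ramp_sum q^n Pi_n(v_i), by induction on n.  The
      operator T glues q rescaled copies of f_n, the k-th one scaled by p_k, and
      prepending the digit k to an index multiplies Pi_n by p_k.
    - [arclength_ramp_sum]: the graph of ramp_sum N c has length
      \sum_i sqrt (1/N^2 + c_i^2).  The grid itself is a partition attaining this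
      value.  That no partition exceeds it follows from [chord_le_ramp_sum]: the
      function L(x) = \sum_i sqrt (1/N^2 + c_i^2) ramp (N x - i), which is the
      length of the graph above [0, x], satisfies chord(x, y) <= L(y) - L(x),
      and these bounds telescope to L(1) - L(0).  An arbitrary partition thus
      never has to be refined by the grid points. *)

Lemma sqrt_sqrD_triangle {R : rcfType} (a b c d : R) :
  Num.sqrt ((a + c) ^+ 2 + (b + d) ^+ 2)
  <= Num.sqrt (a ^+ 2 + b ^+ 2) + Num.sqrt (c ^+ 2 + d ^+ 2).
Proof.
have sq (u v : R) : 0 <= u ^+ 2 + v ^+ 2 by rewrite addr_ge0 ?sqr_ge0.
rewrite -ler_sqr ?nnegrE ?addr_ge0 ?sqrtr_ge0//.
rewrite sqr_sqrtr// [leRHS]sqrrD !sqr_sqrtr// -sqrtrM//.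
have : a * c + b * d
    <= Num.sqrt ((a ^+ 2 + b ^+ 2) * (c ^+ 2 + d ^+ 2)).
  (* Cauchy-Schwarz, from Lagrange's identity *)
  apply: le_trans (ler_norm _) _; rewrite -sqrtr_sqr ler_sqrt; last first.
    by rewrite mulr_ge0.
  rewrite -subr_ge0; have := sqr_ge0 (a * d - b * c); nra.
lra.
Qed.

Lemma sqrt_sum_le_sum_sqrt {R : rcfType} {I : Type} (r : seq I) (a b : I -> R) :
  Num.sqrt ((\sum_(i <- r) a i) ^+ 2 + (\sum_(i <- r) b i) ^+ 2)
  <= \sum_(i <- r) Num.sqrt (a i ^+ 2 + b i ^+ 2).
Proof.
elim: r => [|i r IH]; first by rewrite !big_nil expr0n addr0 sqrtr0.
rewrite !big_cons; apply: le_trans (sqrt_sqrD_triangle _ _ _ _) _.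
by rewrite lerD2l.
Qed.

Section Ramp.
Context {R : realType}.
Implicit Types (x y t : R) (c : nat -> R).

Definition ramp t : R := Num.max 0 (Num.min 1 t).

Lemma ramp_le0 t : t <= 0 -> ramp t = 0.
Proof. by move=> t0; rewrite /ramp max_l// ge_min t0 orbT. Qed.

Lemma ramp_ge1 t : 1 <= t -> ramp t = 1.
Proof. by move=> t1; rewrite /ramp min_l// max_r. Qed.

Lemma ramp_id t : 0 <= t <= 1 -> ramp t = t.
Proof. by case/andP=> t0 t1; rewrite /ramp min_r// max_r. Qed.

Lemma ramp_homo : {homo ramp : x y / x <= y}.
Proof. by move=> x y xy; rewrite /ramp le_max2 ?le_min2. Qed.

Lemma ramp_nat (i j : nat) : ramp (j%:R - i%:R) = (i < j)%:R.
Proof.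
case: ltnP => ij; first by rewrite ramp_ge1// lerBrDr nat1r ler_nat.
by rewrite ramp_le0// subr_le0 ler_nat.
Qed.

(** The unit increments of the ramps tile [0, N]: at most one of them is
    strictly between 0 and 1 at t. *)
Lemma sum_ramp (N : nat) t : 0 <= t <= N%:R ->
  \sum_(0 <= i < N) ramp (t - i%:R) = t.
Proof.
elim: N => [|N IH] /andP[t0 tN].
  by rewrite big_nil; apply/eqP; rewrite eq_le t0.
rewrite big_nat_recr//=; case: (lerP t N%:R) => tN'.
  by rewrite IH ?t0// ramp_le0 ?addr0// subr_le0.
rewrite [ramp _]ramp_id; last by move: tN; rewrite -natr1; lra.
rewrite (eq_big_nat _ _ (F2 := fun=> 1)) => [|i /andP[_ iN]].
  by rewrite sumr_const_nat subn0 subrKC.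
rewrite ramp_ge1//; have : (i.+1)%:R <= N%:R :> R by rewrite ler_nat.
rewrite -natr1; lra.
Qed.

Definition ramp_sum (N : nat) c x : R :=
  \sum_(0 <= i < N) c i * ramp (N%:R * x - i%:R).

(** The abscissa is itself a ramp sum, so that a chord of the graph of
    [ramp_sum N c] becomes one combination of the planar vectors (1/N, c_i). *)
Lemma ramp_sum_id (N : nat) x : (0 < N)%N -> 0 <= x <= 1 ->
  ramp_sum N (fun=> 1 / N%:R) x = x.
Proof.
move=> N0 /andP[x0 x1]; have NR : 0 < N%:R :> R by rewrite ltr0n.
rewrite /ramp_sum -mulr_sumr sum_ramp.
  by rewrite mulrA divrK ?mul1r// unitfE gt_eqF.
by rewrite mulr_ge0//= ler_piMr.
Qed.

Lemma ramp_sum_le0 (N : nat) c x : x <= 0 -> ramp_sum N c x = 0.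
Proof.
move=> x0; apply: big1_seq => i _; rewrite ramp_le0 ?mulr0//.
by rewrite subr_le0 (le_trans (mulr_ge0_le0 _ x0)).
Qed.

Lemma ramp_sum_ge1 (N : nat) c x : 1 <= x ->
  ramp_sum N c x = \sum_(0 <= i < N) c i.
Proof.
move=> x1; apply: eq_big_nat => i /andP[_ iN].
rewrite ramp_ge1 ?mulr1// lerBrDr nat1r.
by rewrite (@le_trans _ _ N%:R) ?ler_nat// ler_peMr.
Qed.

Lemma ramp_sum_increment (N : nat) c (j : nat) : (j < N)%N ->
  ramp_sum N c (j.+1%:R / N%:R) - ramp_sum N c (j%:R / N%:R) = c j.
Proof.
move=> jN; have NR : N%:R != 0 :> R by rewrite pnatr_eq0 -lt0n (leq_trans _ jN).
have E k : ramp_sum N c (k%:R / N%:R) = \sum_(0 <= i < N) c i * (i < k)%:R.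
  by apply: eq_bigr => i _; rewrite mulrCA divff// mulr1 ramp_nat.
rewrite !E -sumrB (eq_bigr (fun i => if i == j then c i else 0)).
  rewrite -big_mkcond /= big_nat1_eq/= jN//.
move=> i _; rewrite -mulrBr ltnS leq_eqVlt.
by case: eqVneq => [->|_]; rewrite ?ltnn ?subr0 ?mulr1//= subrr mulr0.
Qed.

(** Grouping the q * N ramps into q blocks of N exhibits the rescaled copies
    that the die operator produces. *)
Lemma ramp_sum_mul (q N : nat) c x :
  ramp_sum (q * N) c x
  = \sum_(0 <= k < q) ramp_sum N (fun r => c (r + k * N)%N) (q%:R * x - k%:R).
Proof.
rewrite /ramp_sum big_nat_mul; apply: eq_bigr => k _.
rewrite -{1}[(k * N)%N]add0n big_addn mulSn addnK; apply: eq_bigr => r _.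
by congr (_ * ramp _); rewrite !natrD !natrM; lra.
Qed.

(** The chord vector is \sum_i w_i (1/N, c_i), where w_i is the increment of the
    i-th ramp between x and y.  Since w_i >= 0, the triangle inequality bounds
    its norm by \sum_i w_i sqrt (1/N^2 + c_i^2). *)
Lemma chord_le_ramp_sum (N : nat) c x y : (0 < N)%N ->
  0 <= x <= 1 -> 0 <= y <= 1 -> x <= y ->
  Num.sqrt ((y - x) ^+ 2 + (ramp_sum N c y - ramp_sum N c x) ^+ 2)
  <= ramp_sum N (fun i => Num.sqrt ((1 / N%:R) ^+ 2 + c i ^+ 2)) y
     - ramp_sum N (fun i => Num.sqrt ((1 / N%:R) ^+ 2 + c i ^+ 2)) x.
Proof.
move=> N0 x01 y01 xy.
rewrite -{1}(ramp_sum_id N y)// -{1}(ramp_sum_id N x)//.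
rewrite /ramp_sum -!sumrB; apply: le_trans (sqrt_sum_le_sum_sqrt _ _ _) _.
apply: ler_sum => i _; rewrite -!mulrBr.
set w := ramp _ - ramp _.
have w0 : 0 <= w by rewrite subr_ge0 ramp_homo// lerB// ler_wpM2l.
rewrite !exprMn -mulrDl sqrtrM ?addr_ge0 ?sqr_ge0//.
by rewrite sqrtr_sqr ger0_norm.
Qed.

Lemma arclength_ramp_sum (N : nat) c (f : R -> R) : (0 < N)%N ->
  (forall x, 0 <= x <= 1 -> f x = ramp_sum N c x) ->
  arclength 0 1 f
  = (\sum_(0 <= i < N) Num.sqrt ((1 / N%:R) ^+ 2 + c i ^+ 2))%:E.
Proof.
move=> N0 fE; have NR : 0 < N%:R :> R by rewrite ltr0n.
pose l i := Num.sqrt ((1 / N%:R) ^+ 2 + c i ^+ 2).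
apply/eqP; rewrite eq_le; apply/andP; split.
- apply: ge_ereal_sup => _ [s ps <-]; rewrite lee_fin /polygonal_length.
  set X := nth 1 (0 :: s).
  have X01 i : (i <= size s)%N -> 0 <= X i <= 1.
    by move=> si; rewrite itv_partition_nth_ge ?itv_partition_nth_le.
  apply: (@le_trans _ _ (\sum_(0 <= i < size s)
    (ramp_sum N l (X i.+1) - ramp_sum N l (X i)))).
    rewrite !big_nat; apply: ler_sum => i /andP[_ si].
    rewrite !fE ?X01// 1?ltnW//; apply: chord_le_ramp_sum => //.
    + by rewrite X01// ltnW.
    + by rewrite X01.
    + by case: ps => /(pathP 1)/(_ i si)/ltW.
  rewrite telescope_sumr// {1}/X (itv_partition_nth_size _ ps).
  by rewrite ramp_sum_ge1// ramp_sum_le0// subr0.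
- pose s : seq R := [seq i.+1%:R / N%:R | i <- iota 0 N].
  have sN : size s = N by rewrite size_map size_iota.
  have X i : (i <= N)%N -> nth 1 (0 :: s) i = i%:R / N%:R.
    case: i => [_|i iN] /=; first by rewrite mul0r.
    by rewrite (nth_map 0%N) ?size_iota// nth_iota.
  apply: ereal_sup_ubound; exists s.
    split.
      apply/(pathP 1) => i; rewrite sN => iN.
      rewrite (X i (ltnW iN)) -[nth 1 s i]/(nth 1 (0 :: s) i.+1) X//.
      by rewrite ltr_pM2r ?invr_gt0// ltr_nat.
    by rewrite (last_nth 1) sN X// divff ?eqxx ?gt_eqF//.
  congr EFin; rewrite /polygonal_length sN.
  apply: eq_big_nat => i /andP[_ iN]; rewrite !X// 1?ltnW//.
  have cell k : (k <= N)%N -> 0 <= k%:R / N%:R <= (1 : R).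
    by move=> kN; rewrite divr_ge0//= ler_pdivrMr// mul1r ler_nat.
  rewrite !fE ?cell// 1?ltnW// ramp_sum_increment//.
  by rewrite -mulrBl -natr1 addrAC subrr add0r.
Qed.

End Ramp.

Section Die.
Context {R : realType} {q : nat}.
Variable p : q.-tuple R.

(** In base q, k is the leading digit of r + k q^n and the other digits are
    those of r. *)
Lemma coord_prod_die_tupleS (n k r : nat) : (k < q)%N -> (r < q ^ n)%N ->
  coord_prod (die_tuple p n.+1 (r + k * q ^ n))
  = p`_k * coord_prod (die_tuple p n r).
Proof.
move=> kq rn; have qn : (0 < q ^ n)%N by exact: leq_ltn_trans rn.
rewrite /coord_prod big_ord_recl tnth_mktuple /= subSS subn0.
rewrite addnC divnMDl// divn_small// addn0 modn_small//; congr (_ * _).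
apply: eq_bigr => m _; rewrite !tnth_mktuple /= [bump 0 m]add1n subSS.
have -> : (q ^ n = q ^ m * q * q ^ (n - m.+1))%N.
  by rewrite -expnSr -expnD subnKC.
have q0 : (0 < q)%N by exact: leq_ltn_trans kq.
by rewrite mulnA divnMDl ?expn_gt0 ?q0// mulnA modnMDl.
Qed.

Lemma exists_unit_cell (m : nat) (t : R) : (0 < m)%N -> 0 <= t <= m%:R ->
  exists2 k, (k < m)%N & k%:R <= t <= k.+1%:R.
Proof.
elim: m => // -[_ _|m IH _ /andP[t0 tm]]; first by exists 0%N.
have [tm'|mt] := lerP t m.+1%:R; last by exists m.+1; rewrite // ltW.
by have [//||k km kt] := IH; [rewrite t0|exists k; rewrite // ltnW].
Qed.

Hypotheses (q_gt0 : (0 < q)%N) (p_sum1 : \sum_(j < q) p`_j = 1).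

(** At a point x of the k-th cell, block j of the ramp sum of level n + 1 is
    evaluated at q x - j.  This is at least 1 for j < k, so the block contributes
    its full mass p_j; it is at most 0 for j > k, so the block vanishes; and block
    k is p_k f_n(q x - k).  This is the definition of T f_n. *)
Lemma die_iter_ramp_sum (n : nat) (x : R) : 0 <= x <= 1 ->
  die_iter p n x
  = ramp_sum (q ^ n) (fun i => coord_prod (die_tuple p n i)) x.
Proof.
elim: n x => [|n IH] x x01.
  rewrite /ramp_sum expn0 big_nat1 /coord_prod big_ord0.
  by rewrite !mul1r subr0 ramp_id.
have qR : 0 < q%:R :> R by rewrite ltr0n.
set c := fun i => coord_prod (die_tuple p n i) in IH *.
(* the total mass of a block is f_n(1) = 1 *)
have c_sum1 : \sum_(0 <= i < q ^ n) c i = 1.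
  rewrite -(ramp_sum_ge1 _ _ 1)// -IH ?ler01 ?lexx//.
  by have [] := die_iter01 q_gt0 p_sum1 n.
have /andP[x0 x1] := x01.
have [||k kq /andP[kx xk]] := @exists_unit_cell q (q%:R * x) => //.
  by rewrite mulr_ge0//= ler_piMr.
rewrite (@die_iterS _ _ _ q_gt0 p_sum1 n k)//; last first.
  by rewrite ler_pdivrMr// ler_pdivlMr// mulrC kx.
have xk01 : 0 <= q%:R * x - k%:R <= 1 by move: xk; rewrite -natr1; lra.
rewrite expnS ramp_sum_mul IH//.
rewrite (eq_big_nat _ _
  (F2 := fun j => p`_j * ramp_sum (q ^ n) c (q%:R * x - j%:R))); last first.
  move=> j /andP[_ jq]; rewrite /ramp_sum mulr_sumr; apply: eq_big_nat.
  by move=> r /andP[_ rn]; rewrite coord_prod_die_tupleS// mulrA.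
rewrite (big_cat_nat (n := k)) ?(ltnW kq)//= (big_ltn kq).
rewrite [X in _ = _ + (_ + X)]big_nat_cond [X in _ = _ + (_ + X)]big1 ?addr0.
  rewrite -(big_mkord xpredT (fun j => p`_j)); congr (_ + _).
  apply: eq_big_nat => j /andP[_ jk]; rewrite ramp_sum_ge1 ?c_sum1 ?mulr1//.
  have : j.+1%:R <= k%:R :> R by rewrite ler_nat.
  rewrite -natr1; lra.
move=> j /andP[/andP[kj _] _]; rewrite ramp_sum_le0 ?mulr0// subr_le0.
by rewrite (le_trans xk)// ler_nat.
Qed.

End Die.

Theorem theorem4p2 (R : realType) (q : nat) (q_ge2 : (2 <= q)%N)
    (p : q.-tuple R) (p_ge0 : forall j : nat, (j < q)%N -> 0 <= p`_j)
    (p_sum1 : \sum_(j < q) p`_j = 1) (n : nat) (n_ge1 : (1 <= n)%N) :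
  arclength 0 1 (die_iter p n)
  = (\sum_(i < q ^ n)
       Num.sqrt ((1 / (q ^ n)%:R) ^+ 2 + coord_prod (die_tuple p n i) ^+ 2))%:E.
Proof.
have q_gt0 : (0 < q)%N by exact: ltnW.
rewrite (@arclength_ramp_sum _ (q ^ n)
  (fun i => coord_prod (die_tuple p n i))) ?expn_gt0 ?q_gt0 ?big_mkord//.
exact: die_iter_ramp_sum.
Qed.
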